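(* Let $F$ be a Markov chain on a measurable space $S$ and let $A,B\subseteq S$ be measurable. If there exists a lexicographic generalised Streett supermartingale for $(F,(A,B))$, then $\mathbb{P}_{s_0}[\mathbf{Streett}(A,B)] = 1$ for every $s_0 \in S$.
   Context: A Markov chain on a measurable space $S$ is a Markov kernel $F$ from $S$ to $S$; write $F_s$ for $F(s,\cdot)$; for measurable $g:S\to[0,\infty]$, $(\mathbb{X}g)(s)=\int g\,dF_s$, applied componentwise to vector-valued functions. On $[0,\infty]^n$ define $(r_1,\dots,r_n)\succ(r'_1,\dots,r'_n)$ iff there is $l\in\{1,\dots,n\}$ with $r_i\ge r'_i$ for all $i<l$ and $r_l\ge 1+r'_l$; and $r\succeq r'$ iff $r\succ r'$ or $r_i\ge r'_i$ for all $i$. A lexicographic generalised Streett supermartingale (LexGSSM) for $(F,(A,B))$ is a measurable function $r : S\to[0,\infty)^m$ (some $m\ge1$) such that $(\mathbb{X}r)(x)\prec r(x)$ for all $x\in A\setminus B$ and $(\mathbb{X}r)(x)\preceq r(x)$ for all $x\notin A\cup B$. For $s_0 \in S$, $\mathbb{P}_{s_0}$ is the unique probability measure on $S^\omega$ (cylinder $\sigma$-algebra) of trajectories $s_1 s_2 \dots$ such that for measurable $g : S^n \to [0,\infty]$, $\int g(s_1,\dots,s_n)\,d\mathbb{P}_{s_0} = \int\cdots\int g\,dF_{s_{n-1}}(s_n)\cdots dF_{s_0}(s_1)$. $\mathbf{Streett}(A,B)\subseteq S^\omega$ is the set of sequences in which $A$ is visited only finitely often or $B$ is visited infinitely often. 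*)

(* Defs.v *)
From HB Require Import structures.
From mathcomp Require Import all_boot all_order all_algebra.
From mathcomp Require Import all_classical all_reals all_analysis measurable_realfun.

Set Implicit Arguments.
Unset Strict Implicit.
Unset Printing Implicit Defensive.

Import Order.TTheory GRing.Theory Num.Theory.
Import numFieldNormedType.Exports.

Local Open Scope classical_set_scope.
Local Open Scope ring_scope.
Local Open Scope ereal_scope.

(* [lex_gt r r'] is [r \succ r'] and [lex_ge r r'] is [r \succeq r']; they are
   meant for tuples with entries in [0, +oo]. *)
Definition lex_gt (R : realType) (n : nat) (r r' : n.-tuple (\bar R)) : Prop :=
  exists l : 'I_n,
    (forall i : 'I_n, (i < l)%N -> tnth r' i <= tnth r i) /\
    1 + tnth r' l <= tnth r l.

Definition lex_ge (R : realType) (n : nat) (r r' : n.-tuple (\bar R)) : Prop :=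
  lex_gt r r' \/ forall i : 'I_n, tnth r' i <= tnth r i.

Definition next (d : measure_display) (S : measurableType d) (R : realType)
    (F : R.-pker S ~> S) (g : S -> \bar R) (s : S) : \bar R :=
  \int[F s]_y g y.

Definition next_tuple (d : measure_display) (S : measurableType d)
    (R : realType) (F : R.-pker S ~> S) (n : nat) (g : S -> n.-tuple (\bar R))
    (s : S) : n.-tuple (\bar R) :=
  [tuple next F (fun y => tnth (g y) i) s | i < n].

Definition fin_tuple (R : realType) (n : nat) (t : n.-tuple R) :
    n.-tuple (\bar R) :=
  [tuple (tnth t i)%:E | i < n].

Record LexGSSM (d : measure_display) (S : measurableType d) (R : realType)
    (F : R.-pker S ~> S) (A B : set S) (m : nat) (r : S -> m.-tuple R) :
    Prop := {
  LexGSSM_dim : (0 < m)%N;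
  LexGSSM_measurable : measurable_fun [set: S] r;
  LexGSSM_ge0 : forall (s : S) (i : 'I_m), (0 <= tnth (r s) i)%R;
  LexGSSM_gt : forall x : S, (A `\` B) x ->
    lex_gt (fin_tuple (r x)) (next_tuple F (fun y => fin_tuple (r y)) x);
  LexGSSM_ge : forall x : S, ~ (A `|` B) x ->
    lex_ge (fin_tuple (r x)) (next_tuple F (fun y => fin_tuple (r y)) x)
}.

(* A trajectory [s_1 s_2 ...] is a function [w : nat -> S] with
   [w i = s_(i + 1)]: the initial state [s_0] is not part of it. *)
Definition cylinders (d : measure_display) (S : measurableType d) :
    set (set (nat -> S)) :=
  [set C | exists (k : nat) (U : set S),
    measurable U /\ C = [set w : nat -> S | U (w k)]].

Definition trajectory (d : measure_display) (S : measurableType d) :=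
  g_sigma_algebraType (@cylinders d S).

Definition prefix_tuple (S : Type) (n : nat) (w : nat -> S) : n.-tuple S :=
  [tuple w i | i < n].

(* [iterated_integral F s_0 g] is
   [\int .. \int g (s_1, .., s_n) dF_(s_(n-1))(s_n) .. dF_(s_0)(s_1)]. *)
Fixpoint iterated_integral (d : measure_display) (S : measurableType d)
    (R : realType) (F : R.-pker S ~> S) (n : nat) (s : S) {struct n} :
    (n.-tuple S -> \bar R) -> \bar R :=
  match n with
  | 0%N => fun g => g [tuple]
  | n'.+1 => fun g => \int[F s]_x
      iterated_integral F x (fun t : n'.-tuple S => g [tuple of x :: t])
  end.

(* The property that characterises [P_(s_0)] among all probability measures on
   the cylinder sigma-algebra. *)
Definition is_trajectory_measure (d : measure_display) (S : measurableType d)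
    (R : realType) (F : R.-pker S ~> S) (s0 : S)
    (P : probability (trajectory S) R) : Prop :=
  forall (n : nat) (g : n.-tuple S -> \bar R),
    measurable_fun [set: n.-tuple S] g -> (forall t, 0 <= g t) ->
    \int[P]_w g (prefix_tuple n w) = iterated_integral F s0 g.

Definition Streett (S : Type) (A B : set S) : set (nat -> S) :=
  [set w | finite_set [set n | A (w n)] \/ infinite_set [set n | B (w n)]].

(* Main.v *)
(** For each level [l], let [D l] be the set of states where component [l] drops
    by at least 1 in expectation while the lower components do not increase, and [E l] the
    set of states outside [B] and outside all [D i] with [i < l].  On [E l] the
    component [r_l] satisfies [1_(D l) + X r_l <= r_l], so, starting from [x], the
    expected number of visits to [D l] before leaving [E l] is at most [r_l x],
    hence finite.  Therefore almost every trajectory that eventually stays in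
    [E l] visits [D l] finitely often.  By induction on [l], if [B] is visited
    finitely often then so is every [D l], and their union covers [A `\` B]. *)
Require Import Defs.
From HB Require Import structures.
From mathcomp Require Import all_boot all_order all_algebra.
From mathcomp Require Import all_classical all_reals all_analysis measurable_realfun.
From mathcomp Require Import zify.

Import Order.TTheory GRing.Theory Num.Theory.
Import numFieldNormedType.Exports.

Local Open Scope classical_set_scope.
Local Open Scope ring_scope.
Local Open Scope ereal_scope.

(** Recasts finitely many visits as a property of the filter at infinity, so that finitely many such
    facts can be intersected. *)
Lemma finite_set_near (A : set nat) :
  finite_set A <-> \forall n \near \oo, ~ A n.
Proof.
split=> [|[N _ NA]]; last first.
  apply: (sub_finite_set _ (finite_II N)) => n An /=.
  by rewrite ltnNge; apply/negP => /NA.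
move/finite_seqP => [s ->].
exists (\max_(i <- s) i).+1 => // n /= + ns; apply/negP; rewrite -leqNgt.
exact: (@leq_bigmax_seq _ s xpredT id).
Qed.

Lemma drop_prefix_tuple {S : Type} (w : nat -> S) (n k : nat) :
  drop k (prefix_tuple n w) = [seq w i | i <- iota k (n - k)].
Proof. by rewrite /= map_comp val_enum_ord -map_drop drop_iota. Qed.

(* Unlike [ge0_le_integral], no measurability is assumed; this is what allows
   bounding iterated integrals without showing that they are measurable in the
   initial state. *)
Lemma ge0_le_integral_nomeas {d : measure_display} {T : measurableType d}
    {R : realType} (mu : {measure set T -> \bar R}) (f g : T -> \bar R) :
  (forall x, 0 <= f x) -> (forall x, f x <= g x) ->
  \int[mu]_x f x <= \int[mu]_x g x.
Proof.
move=> f0 fg; rewrite !ge0_integralTE//; last first.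
  by move=> x; exact: le_trans (fg x).
apply: le_ereal_sup => _ [h /= hf <-]; exists h => //= x.
exact: le_trans (fg x).
Qed.

(** * Measurability of the Streett event *)

Section trajectories.
Context {d : measure_display} {S : measurableType d}.

Lemma measurable_coordinate (k : nat) :
  measurable_fun [set: trajectory S] (fun w : trajectory S => (w : nat -> S) k).
Proof.
move=> _ U mU; rewrite setTI; apply: sub_sigma_algebra.
by exists k, U.
Qed.

Lemma measurable_near_coordinate (U : set S) : measurable U ->
  measurable [set w : trajectory S | \forall n \near \oo, ~ U (w n)].
Proof.
move=> mU; rewrite [X in measurable X](_ : _ = \bigcup_N
    \bigcap_(n in [set n | (N <= n)%N])
      ((fun w : trajectory S => (w : nat -> S) n) @^-1` ~` U)); last first.
  apply/seteqP; split=> w /=.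
    by move=> [N _ NU]; exists N.
  by move=> [N _ NU]; exists N.
apply: bigcupT_measurable => N; apply: bigcap_measurableType => n _.
rewrite -[X in measurable X]setTI; apply: measurable_coordinate => //.
exact: measurableC.
Qed.

Lemma measurable_Streett (A B : set S) : measurable A -> measurable B ->
  measurable (Streett A B : set (trajectory S)).
Proof.
move=> mA mB; rewrite [X in measurable X](_ : _ =
    [set w : trajectory S | \forall n \near \oo, ~ A (w n)] `|`
    ~` [set w : trajectory S | \forall n \near \oo, ~ B (w n)]); last first.
  by apply/seteqP; split=> w [] /finite_set_near; [left|right|left|right].
apply: measurableU; first exact: measurable_near_coordinate.
by apply: measurableC; exact: measurable_near_coordinate.
Qed.

End trajectories.

(** * Elementary bounds on iterated integrals *)

Section iterated_integral.
Context {d : measure_display} {S : measurableType d} {R : realType}.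
Variable F : R.-pker S ~> S.

Lemma iterated_integral_ge0 (n : nat) (s : S) (g : n.-tuple S -> \bar R) :
  (forall t, 0 <= g t) -> 0 <= iterated_integral F s g.
Proof.
elim: n s g => [|n IH] s g g0 /=; first exact: g0.
by apply: integral_ge0 => x _; exact: IH.
Qed.

Lemma integral_pker_le (x : S) (f : S -> \bar R) (c : \bar R) :
  (forall y, 0 <= f y) -> (forall y, f y <= c) -> \int[F x]_y f y <= c.
Proof.
move=> f0 fc; rewrite -[leRHS]mule1 -(prob_kernel (s := F) x) -integral_cst//.
exact: ge0_le_integral_nomeas.
Qed.

Lemma iterated_integral_le (n : nat) (s : S) (g : n.-tuple S -> \bar R)
    (c : \bar R) :
  (forall t, 0 <= g t) -> (forall t, g t <= c) -> iterated_integral F s g <= c.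
Proof.
elim: n s g => [|n IH] s g g0 gc /=; first exact: gc.
apply: integral_pker_le => x; last exact: IH.
exact: iterated_integral_ge0.
Qed.

End iterated_integral.

(** * Counting visits to [L] before leaving [E] *)

Section visits.
Context {d : measure_display} {S : measurableType d} {R : realType}.
Variables (E L : set S) (v : S -> R).

(* [c] plus the number of visits to [L] before the first exit from [E]; the
   accumulator [c] makes the bound on the expectation go through by induction
   with no additivity of iterated integrals. *)
Fixpoint visits (c : R) (s : seq S) : R :=
  if s is x :: s' then
    if x \in E then visits (c + \1_L x)%R s' else c
  else c.

(* Counts from time [k] on, and only if [v <= M] at that time: [v] need not be
   integrable at time [k], so without the cap the expectation may be infinite. *)
Definition capped_visits (k : nat) (M : R) (s : seq S) : R :=
  if drop k s is x :: s' then
    if (v x <= M)%R then visits 0 (x :: s') else 0%R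
  else 0%R.

Lemma visits_ge (c : R) (s : seq S) : (c <= visits c s)%R.
Proof.
elim: s c => //= x s IH c; case: ifP => // _.
by apply: le_trans (IH _); rewrite lerDl.
Qed.

Lemma capped_visits_ge0 (k : nat) (M : R) (s : seq S) :
  (0 <= capped_visits k M s)%R.
Proof.
rewrite /capped_visits; case: (drop k s) => // x s'.
by case: ifP => // _; exact: visits_ge.
Qed.

Lemma visits_staying (c : R) (s : seq S) : {in s, forall x, E x} ->
  visits c s = (c + (count (mem L) s)%:R)%R.
Proof.
elim: s c => /= [|x s IH] c Es; first by rewrite addr0.
rewrite mem_set; last by apply: Es; rewrite mem_head.
rewrite IH => [|y ys]; last by apply: Es; rewrite in_cons ys orbT.
by rewrite natrD addrA indicE.
Qed.

Section measurability.
Hypotheses (mE : measurable E) (mL : measurable L)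
  (mv : measurable_fun [set: S] v).
Context {d' : measure_display} {T : measurableType d'}.

(** The family [f] covers both the coordinates of a trajectory and the entries of a tuple. The
    accumulator depends on [t] because each recursive call adds an indicator to it. *)
Lemma measurable_visits {I : Type} (f : I -> T -> S) (c : T -> R) (s : seq I) :
  (forall i, measurable_fun [set: T] (f i)) -> measurable_fun [set: T] c ->
  measurable_fun [set: T] (fun t => visits (c t) [seq f i t | i <- s]).
Proof.
move=> mf; elim: s c => //= i s IH c mc; apply: measurable_fun_ifT => //.
  apply: (measurable_fun_bool true); rewrite setTI.
  rewrite [X in measurable X](_ : _ = f i @^-1` E).
    by rewrite -[X in measurable X]setTI; exact: mf.
  by apply/seteqP; split=> t; [exact: set_mem|exact: mem_set].
apply: IH; apply: measurable_funD => //.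
by apply: (measurableT_comp (measurable_indic mL)).
Qed.

Lemma measurable_capped_visits {I : Type} (f : I -> T -> S) (k : nat) (M : R)
    (s : seq I) :
  (forall i, measurable_fun [set: T] (f i)) ->
  measurable_fun [set: T]
    (fun t => (capped_visits k M [seq f i t | i <- s])%:E).
Proof.
move=> mf; apply: measurableT_comp => //; rewrite /capped_visits.
under eq_fun do rewrite -map_drop.
case: (drop k s) => [|i s']; first exact: measurable_cst.
apply: measurable_fun_ifT => //.
  by apply: measurable_fun_ler => //; exact: measurableT_comp.
exact: (@measurable_visits _ f (cst 0%R) (i :: s')).
Qed.

End measurability.

Section expectation.
Variable F : R.-pker S ~> S.
Hypotheses (mv : measurable_fun [set: S] v) (v0 : forall x, (0 <= v x)%R).
Hypothesis drift : forall x, E x ->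
  (\1_L x)%:E + \int[F x]_y (v y)%:E <= (v x)%:E.

(** Induction on the number of steps. Inside [E] the accumulator grows by [\1_L y], which [drift]
    pays for with the expected drop of [v]; outside [E] the count stops at [c], and [v] is
    nonnegative. *)
Lemma iterated_visits_le (n : nat) (c : R) (y : S) : (0 <= c)%R ->
  iterated_integral F y (fun t : n.-tuple S => (visits c (y :: t))%:E)
    <= (c + v y)%:E.
Proof.
elim: n c y => [|n IH] c y c0.
  rewrite /=; case: ifPn => [/set_mem Ey|_]; last by rewrite lee_fin lerDl.
  rewrite lee_fin lerD2l -lee_fin; apply: le_trans (drift y Ey).
  by rewrite leeDl// integral_ge0// => z _; rewrite lee_fin.
have [Ey|nEy] := boolP (y \in E); last first.
  rewrite /= (negbTE nEy); apply: integral_pker_le => z.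
    by apply: iterated_integral_ge0 => t; rewrite lee_fin.
  by apply: iterated_integral_le => t; rewrite lee_fin// lerDl.
have c1 : (0 <= c + \1_L y)%R by rewrite addr_ge0.
rewrite [leLHS](_ : _ = \int[F y]_z iterated_integral F z
    (fun t : n.-tuple S => (visits (c + \1_L y) (z :: t))%:E)); last first.
  by rewrite /= Ey.
(* The induction hypothesis is used at the accumulator [c + \1_L y]. *)
apply: (@le_trans _ _ (\int[F y]_z ((c + \1_L y)%:E + (v z)%:E))).
  apply: ge0_le_integral_nomeas => z; last exact: IH.
  apply: iterated_integral_ge0 => t; rewrite lee_fin.
  exact: le_trans (visits_ge _ _).
rewrite ge0_integralD//=; last 2 first.
- by move=> z _; rewrite lee_fin.
- exact: measurableT_comp.
rewrite integral_cst// prob_kernel mule1 !EFinD -addeA leeD2l//.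
exact/drift/set_mem.
Qed.

(** At time [k] either the cap fails and the count is 0, or the expected count is at most [v <= M].
    Averaging over the earlier steps preserves the bound, each kernel having mass 1. *)
Lemma iterated_capped_visits_le (n k : nat) (M : R) (y : S) : (0 <= M)%R ->
  iterated_integral F y (fun t : n.-tuple S => (capped_visits k M t)%:E)
    <= M%:E.
Proof.
move=> M0; elim: n k y => [|n IH] [|k] y; rewrite ?lee_fin//=.
- apply: integral_pker_le => z.
    by apply: iterated_integral_ge0 => t; rewrite lee_fin capped_visits_ge0.
  rewrite /capped_visits /=; have [vM|Mv] := leP (v z) M; last first.
    by apply: iterated_integral_le => t; rewrite lee_fin.
  apply: (le_trans (iterated_visits_le n 0 z (lexx _))).
  by rewrite add0r lee_fin.
- apply: integral_pker_le => z; last exact: IH.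
  by apply: iterated_integral_ge0 => t; rewrite lee_fin capped_visits_ge0.
Qed.

Hypotheses (mE : measurable E) (mL : measurable L).
Variables (s0 : S) (P : probability (trajectory S) R).
Hypothesis PF : is_trajectory_measure F s0 P.

Lemma measurable_capped_visits_prefix (k : nat) (M : R) (n : nat) :
  measurable_fun [set: trajectory S]
    (fun w : trajectory S => (capped_visits k M (prefix_tuple n w))%:E).
Proof.
apply: (@measurable_capped_visits mE mL mv _ _ _
  (fun (i : 'I_n) (w : trajectory S) => (w : nat -> S) i)) => i.
exact: measurable_coordinate.
Qed.

Lemma integral_capped_visits_le (k n : nat) (M : R) : (0 <= M)%R ->
  \int[P]_w (capped_visits k M (prefix_tuple n w))%:E <= M%:E.
Proof.
move=> M0; rewrite (PF n (fun t => (capped_visits k M t)%:E)).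
- exact: iterated_capped_visits_le.
- rewrite (_ : (fun t => _) = fun t : n.-tuple S => (capped_visits k M
    [seq (tnth (T:=S))^~ i t | i <- enum 'I_n])%:E); last first.
    by apply/funext => t /=; rewrite map_tnth_enum.
  by apply: measurable_capped_visits => // i; exact: measurable_tnth.
- by move=> t; rewrite lee_fin capped_visits_ge0.
Qed.

(** By Fatou, the lower limit of the counts has integral at most [M], so it is finite almost
    everywhere. *)
Lemma capped_visits_cvgy_negligible (k : nat) (M : R) : (0 <= M)%R ->
  P.-negligible [set w : trajectory S |
    (capped_visits k M (prefix_tuple n w))%:E @[n --> \oo] --> +oo].
Proof.
move=> M0.
pose f n (w : trajectory S) := (capped_visits k M (prefix_tuple n w))%:E.
have f0 n w : 0 <= f n w by rewrite lee_fin capped_visits_ge0.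
have mf n : measurable_fun [set: trajectory S] (f n).
  exact: measurable_capped_visits_prefix.
have lf0 w : 0 <= limn_einf (f^~ w).
  rewrite limn_einf_lim; apply: lime_ge; first exact: is_cvg_einfs.
  by apply: nearW => n; apply: le_ereal_inf_tmp => _ [i /= _ <-].
have intf : P.-integrable [set: trajectory S] (fun w => limn_einf (f^~ w)).
  apply/integrableP; split.
    (* Measurability of the lower limit is deduced from that of the upper limit of the opposites. *)
    rewrite (_ : (fun w => _) = (fun w => - limn_esup ((fun n => \- f n)^~ w))).
      apply: measurableT_comp => //; apply: measurable_fun_limn_esup => n.
      exact: measurableT_comp.
    by apply/funext => w; rewrite limn_esupN oppeK.
  apply: (@le_lt_trans _ _ M%:E); last exact: ltry.
  under eq_integral do rewrite gee0_abs//.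
  apply: (le_trans (fatou _ _ mf _)) => //.
  rewrite limn_einf_lim; apply: lime_le; first exact: is_cvg_einfs.
  apply: nearW => n; apply: ge_ereal_inf; exists (\int[P]_w f n w).
    by exists n => /=.
  exact: integral_capped_visits_le.
apply: negligibleS (integrable_ae measurableT intf) => w /= fw.
by move=> /(_ Logic.I); rewrite (cvg_limn_einf_sup fw).1.
Qed.

Lemma count_infinitely_often (w : nat -> S) (k c : nat) :
  ~ (\forall n \near \oo, ~ L (w n)) ->
  \forall n \near \oo, (c <= count (mem L) (drop k (prefix_tuple n w)))%N.
Proof.
move=> Lio; elim: c => [|c [N _ IH]]; first exact: nearW.
have [j jNk Lj] : exists2 j, (maxn N k <= j)%N & L (w j).
  apply: contrapT => noj; apply: Lio; exists (maxn N k) => // n /= Nn Ln.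
  by apply: noj; exists n.
move: jNk; rewrite geq_max => /andP[Nj kj].
exists j.+1 => // n /= jn; rewrite drop_prefix_tuple.
(* Splits the list just before time [j]: the first block already holds [c] visits, and the second
   begins with one more. *)
have -> : (n - k = (j - k) + (n - j.+1).+1)%N by lia.
rewrite iotaD map_cat count_cat subnKC//= mem_set//= addnCA add1n ltnS.
apply: leq_trans (leq_addr _ _).
by have := IH j Nj; rewrite /= drop_prefix_tuple.
Qed.

(** Such a trajectory is in [E] from some time [k] on, and some natural number [M] bounds [v] at
    that time. From [k] on every visit to [L] is counted, so the capped count diverges; there are
    only countably many pairs [k], [M]. *)
Lemma visits_negligible :
  P.-negligible [set w : trajectory S |
    (\forall n \near \oo, E (w n)) /\ ~ (\forall n \near \oo, ~ L (w n))].
Proof.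
apply: (negligibleS (A := \bigcup_k \bigcup_M [set w : trajectory S |
    (capped_visits k M%:R (prefix_tuple n w))%:E @[n --> \oo] --> +oo])).
  move=> w /= [[k _ Ek] Lio]; exists k => //.
  exists (Num.truncn (v (w k))).+1 => //=; apply/cvgeyPge => c.
  have := count_infinitely_often w k (Num.truncn c).+1 Lio.
  apply: filterS2 (nbhs_infty_gt k) => n kn.
  have dropE : drop k (prefix_tuple n w) =
      w k :: [seq w i | i <- iota k.+1 (n - k.+1)].
    rewrite drop_prefix_tuple.
    by have -> : (n - k = (n - k.+1).+1)%N by lia.
  rewrite /capped_visits dropE => Lc.
  rewrite (ltW (truncnS_gt (v (w k)))) visits_staying.
    rewrite add0r lee_fin; apply: (@le_trans _ _ (Num.truncn c).+1%:R).
      exact/ltW/truncnS_gt.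
    by rewrite ler_nat.
  move=> x; rewrite in_cons => /predU1P[->|/mapP[i + ->]].
    exact: (Ek k (leqnn k)).
  by rewrite mem_iota => /andP[ki _]; apply: Ek; exact: ltnW.
apply: negligible_bigcup => k; apply: negligible_bigcup => M.
exact: capped_visits_cvgy_negligible.
Qed.

End expectation.
End visits.

(** * From the lexicographic order to a drift condition at each level *)

Section lexicographic.
Context {d : measure_display} {S : measurableType d} {R : realType}.
Variables (F : R.-pker S ~> S) (m : nat) (r : S -> m.-tuple R).
Hypothesis mr : measurable_fun [set: S] r.
Hypothesis r0 : forall s i, (0 <= tnth (r s) i)%R.

Let Xr (l : 'I_m) (x : S) := \int[F x]_y (tnth (r y) l)%:E.

Definition decrease (l : 'I_m) : set S :=
  [set x | 1 + Xr l x <= (tnth (r x) l)%:E] `&`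
  \bigcap_(i in [set i : 'I_m | (i < l)%N])
    [set x | Xr i x <= (tnth (r x) i)%:E].

Let mrl l : measurable_fun [set: S] (fun x => (tnth (r x) l)%:E).
Proof.
apply: measurableT_comp => //.
exact: (measurableT_comp (measurable_tnth l) mr).
Qed.

Let mXr l : measurable_fun [set: S] (Xr l).
Proof.
apply: measurable_fun_integral_kernel => //.
- by move=> U mU; exact: measurable_kernel.
- by move=> z; rewrite lee_fin.
Qed.

Lemma measurable_decrease (l : 'I_m) : measurable (decrease l).
Proof.
apply: measurableI.
  rewrite -[X in measurable X]setTI; apply: measurable_lee => //.
  exact: emeasurable_funD.
apply: fin_bigcap_measurable => // i _.
by rewrite -[X in measurable X]setTI; exact: measurable_lee.
Qed.

Let nextE i x : tnth (next_tuple F (fun y => fin_tuple (r y)) x) i = Xr i x.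
Proof.
by rewrite tnth_mktuple; apply: eq_integral => y _; rewrite tnth_mktuple.
Qed.

Lemma lex_gt_decrease (x : S) :
  lex_gt (fin_tuple (r x)) (next_tuple F (fun y => fin_tuple (r y)) x) ->
  exists l, decrease l x.
Proof.
move=> [l [lt_l ge_l]]; exists l; split=> [|i il] /=.
  by move: ge_l; rewrite nextE tnth_mktuple.
by have := lt_l i il; rewrite nextE tnth_mktuple.
Qed.

(** On [decrease l] the bound is its first clause. Elsewhere the indicator vanishes, and a strict
    decrease can only have its witness above [l], which keeps component [l] from increasing in
    expectation. *)
Lemma lex_ge_drift (l : 'I_m) (x : S) :
  lex_ge (fin_tuple (r x)) (next_tuple F (fun y => fin_tuple (r y)) x) ->
  (forall i : 'I_m, (i < l)%N -> ~ decrease i x) ->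
  (\1_(decrease l) x)%:E + \int[F x]_y (tnth (r y) l)%:E
    <= (tnth (r x) l)%:E.
Proof.
move=> gex ndec; rewrite indicE.
have [/set_mem[//]|/negP ndl] := boolP (x \in decrease l).
rewrite add0e; case: gex => [/lex_gt_decrease[j decj]|/(_ l)]; last first.
  by rewrite nextE tnth_mktuple.
have [jl|lj|/val_inj jl] := ltngtP j l.
- by case: (ndec j jl).
- exact: (decj.2 l lj).
- by case: ndl; rewrite -jl; exact: mem_set.
Qed.

End lexicographic.

Theorem theorem4p10 (R : realType) (d : measure_display) (S : measurableType d)
    (F : R.-pker S ~> S) (A B : set S)
    (mA : measurable A) (mB : measurable B) :
  (exists (m : nat) (r : S -> m.-tuple R), LexGSSM F A B r) ->
  forall (s0 : S) (P : probability (trajectory S) R),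
    is_trajectory_measure F s0 P -> P (Streett A B) = 1.
Proof.
move=> [m [r [_ mr r0 r_gt r_ge]]] s0 P PF.
pose D := decrease F m r.
pose E (l : 'I_m) := ~` B `&` \bigcap_(i in [set i : 'I_m | (i < l)%N]) ~` D i.
have mE l : measurable (E l).
  apply: measurableI; first exact: measurableC.
  apply: fin_bigcap_measurable => // i _.
  by apply: measurableC; exact: measurable_decrease.
have drift l x : E l x ->
    (\1_(D l) x)%:E + \int[F x]_y (tnth (r y) l)%:E <= (tnth (r x) l)%:E.
  move=> [nB nD]; apply: lex_ge_drift nD.
  have [Ax|nA] := pselect (A x); first by left; apply: r_gt.
  by apply: r_ge => -[].
have aeP : Filter (almost_everywhere P) := ae_filter_ringOfSetsType P.
(* A single null set serves all levels, so the induction on [l] below runs along one fixed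
   trajectory. *)
have D_fin : \forall w \ae P, forall l,
    (\forall n \near \oo, E l (w n)) -> \forall n \near \oo, ~ D l (w n).
  apply: filter_forall => l.
  have mrl : measurable_fun [set: S] (fun x => tnth (r x) l).
    exact: (measurableT_comp (measurable_tnth l) mr).
  have mDl : measurable (D l) by exact: measurable_decrease.
  apply: negligibleS (visits_negligible _ _ _ F mrl (r0 ^~ l) (drift l)
    (mE l) mDl s0 P PF) => w /= /not_implyP.
  exact.
have null : P.-negligible (~` (Streett A B : set (trajectory S))).
  apply: filterS D_fin => w D_fin.
  have [finB|infB] := pselect (finite_set [set n | B (w n)]); last by right.
  move/finite_set_near in finB.
  have {}D_fin l : \forall n \near \oo, ~ D l (w n).
    have [k] := ubnP (nat_of_ord l); elim: k l => // k IH l; rewrite ltnS => lk.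
    have D_lt : \forall n \near \oo,
        forall i : 'I_m, (i < l)%N -> ~ D i (w n).
      apply: filter_forall => i; have [il|li] := ltnP i l; last exact: nearW.
      by apply: filterS (IH i (leq_trans il lk)).
    (* Leaving [B] and all lower [D i] for good amounts to staying in [E l]. *)
    by apply: D_fin; apply: filterS2 finB D_lt => n; split.
  have {}D_fin : \forall n \near \oo, forall l, ~ D l (w n).
    exact: filter_forall.
  left; apply/finite_set_near; apply: filterS2 finB D_fin.
  move=> n nB nD An.
  by have [l] := lex_gt_decrease _ _ _ _ (r_gt _ (conj An nB)); exact: nD.
have mStr := measurable_Streett A B mA mB.
rewrite -[Streett A B]setCK probability_setC; last exact: measurableC.
by rewrite (measure_negligible (measurableC mStr) null) sube0.
Qed.
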